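(* Let $\mathcal{M}=\langle M,\circ,e\rangle$ be an effective mge monoid and let $m,n\in M$ be such that the equation $mx=n$ has a solution. Then the solution can be effectively computed from $m$ and $n$.
   Context: A tuple $\langle m_1,\dots,m_n\rangle$ is equalizable if some $\langle x_1,\dots,x_n\rangle$ (an equalizer) satisfies $m_1x_1=\dots=m_nx_n$; an equalizer is a most general equalizer (mge) if every equalizer has the form $\langle x_1x,\dots,x_nx\rangle$, $x\in M$. An mge monoid has right cancellation ($ac=bc\Rightarrow a=b$) and an mge for every equalizable pair. It is effective if elements are represented as a recursive subset of $\mathbb{N}$ with computable operation, equality is decidable, equalizability of pairs is decidable, a computable $\eta:M^2\to M^2$ returns an mge for each equalizable pair, and for each invertible element $m$ (i.e. $mn=e$ for some $n$) its inverse $m^{-1}$ is computable. *)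

(* Defs.v *)
(* A small, explicit model of computability (partial recursive
   functions on nat, unary basis with Cantor pairing), so that "effectively
   computable" is not trivialised by the whitelisted choice axioms. *)
From Stdlib Require Import Arith.

Definition cpair (x y : nat) : nat := (x + y) * S (x + y) / 2 + y.

(* Codes of partial recursive functions nat -> nat (unary, using pairing). *)
Inductive prog : Type :=
| PZero
| PSucc
| PId
| PFst
| PSnd
| PPair (f g : prog)
| PComp (f g : prog)
| PPrim (f g : prog)
| PMu (f : prog).

Inductive eval : prog -> nat -> nat -> Prop :=
| ev_zero x : eval PZero x 0
| ev_succ x : eval PSucc x (S x)
| ev_id x : eval PId x x
| ev_fst x y : eval PFst (cpair x y) x
| ev_snd x y : eval PSnd (cpair x y) y
| ev_pair f g x a b : eval f x a -> eval g x b -> eval (PPair f g) x (cpair a b)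
| ev_comp f g x y z : eval g x y -> eval f y z -> eval (PComp f g) x z
| ev_prim0 f g x a : eval f x a -> eval (PPrim f g) (cpair x 0) a
| ev_primS f g x n a b :
    eval (PPrim f g) (cpair x n) a -> eval g (cpair x (cpair n a)) b ->
    eval (PPrim f g) (cpair x (S n)) b
| ev_mu f x n : search f x 0 n -> eval (PMu f) x n
with search : prog -> nat -> nat -> nat -> Prop :=
| se_stop f x i : eval f (cpair x i) 0 -> search f x i i
| se_step f x i k n : eval f (cpair x i) (S k) -> search f x (S i) n -> search f x i n.

Section Monoid.
Variables (M : Type) (op : M -> M -> M) (e : M).

Definition is_monoid : Prop :=
  (forall a b c, op a (op b c) = op (op a b) c) /\
  (forall a, op e a = a) /\ (forall a, op a e = a).

Definition right_cancellative : Prop :=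
  forall a b c, op a c = op b c -> a = b.

Definition is_equalizer (m1 m2 x1 x2 : M) : Prop := op m1 x1 = op m2 x2.

Definition equalizable (m1 m2 : M) : Prop := exists x1 x2, is_equalizer m1 m2 x1 x2.

Definition is_mge (m1 m2 x1 x2 : M) : Prop :=
  is_equalizer m1 m2 x1 x2 /\
  forall y1 y2, is_equalizer m1 m2 y1 y2 ->
    exists x, y1 = op x1 x /\ y2 = op x2 x.

Definition invertible (m : M) : Prop := exists n, op m n = e.

Definition mge_monoid : Prop :=
  is_monoid /\ right_cancellative /\
  forall m1 m2, equalizable m1 m2 -> exists x1 x2, is_mge m1 m2 x1 x2.

Definition effective (enc : M -> nat) : Prop :=
  (forall a b, enc a = enc b -> a = b) /\
  (exists c, forall k, exists r, eval c k r /\ (r = 1 <-> exists a, enc a = k)) /\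
  (exists c, forall a b, eval c (cpair (enc a) (enc b)) (enc (op a b))) /\
  (exists c, forall a b, exists r, eval c (cpair (enc a) (enc b)) r /\ (r = 1 <-> a = b)) /\
  (exists c, forall a b, exists r, eval c (cpair (enc a) (enc b)) r /\
                                   (r = 1 <-> equalizable a b)) /\
  (* a computable eta : M^2 -> M^2 returning an mge for every equalizable pair *)
  (exists c, forall a b, exists y1 y2,
      eval c (cpair (enc a) (enc b)) (cpair (enc y1) (enc y2)) /\
      (equalizable a b -> is_mge a b y1 y2)) /\
  (exists c, forall m, invertible m -> exists y,
      eval c (enc m) (enc y) /\ op m y = e /\ op y m = e).

End Monoid.

(* Main.v *)
(* If [m x = n], then [<x, e>] equalizes [<m, n>], so the mge [<y1, y2>]
   returned by eta satisfies [e = y2 z] for some [z]: [y2] is invertible.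
   With [w] its computable inverse, [y1 w] solves the equation, because
   [m y1 w = n y2 w = n]. *)
Require Import Defs.

Section Solving.
Variables (M : Type) (op : M -> M -> M) (e : M).
Hypothesis op_assoc : forall a b c, op a (op b c) = op (op a b) c.
Hypothesis op_e : forall a, op a e = a.

Lemma solution_equalizer (m n x : M) :
  op m x = n -> is_equalizer M op m n x e.
Proof. intros Hx. unfold is_equalizer. now rewrite op_e. Qed.

Lemma mge_right_invertible (m n y1 y2 : M) :
  is_mge M op m n y1 y2 -> (exists x, op m x = n) -> invertible M op e y2.
Proof.
  intros [_ Hgen] [x Hx].
  destruct (Hgen x e (solution_equalizer m n x Hx)) as [z [_ Hz]].
  now exists z.
Qed.

Lemma equalizer_solution (m n y1 y2 w : M) :
  is_equalizer M op m n y1 y2 -> op y2 w = e -> op m (op y1 w) = n.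
Proof.
  unfold is_equalizer. intros Hy Hw.
  now rewrite op_assoc, Hy, <- op_assoc, Hw, op_e.
Qed.

End Solving.

(* On input [<a, b>]: run [ceta], apply [cinv] to the second component of
   its output, and feed the first component together with that to [cop]. *)
Definition solve_prog (cop ceta cinv : prog) : prog :=
  PComp cop (PPair (PComp PFst ceta) (PComp cinv (PComp PSnd ceta))).

Lemma eval_solve_prog (cop ceta cinv : prog) (k p q r s : nat) :
  eval ceta k (cpair p q) -> eval cinv q r -> eval cop (cpair p r) s ->
  eval (solve_prog cop ceta cinv) k s.
Proof.
  intros Heta Hinv Hop.
  apply ev_comp with (y := cpair p r); [| exact Hop].
  apply ev_pair.
  - apply ev_comp with (y := cpair p q); [exact Heta | apply ev_fst].
  - apply ev_comp with (y := q); [| exact Hinv].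
    apply ev_comp with (y := cpair p q); [exact Heta | apply ev_snd].
Qed.

Theorem corollary1 (M : Type) (op : M -> M -> M) (e : M) (enc : M -> nat) :
  mge_monoid M op e -> effective M op e enc ->
  exists c : prog, forall m n : M, (exists x, op m x = n) ->
    exists x, eval c (cpair (enc m) (enc n)) (enc x) /\ op m x = n.
Proof.
  intros [[op_assoc [_ op_e]] _]
    [_ [_ [[cop Hop] [_ [_ [[ceta Heta] [cinv Hinv]]]]]]].
  exists (solve_prog cop ceta cinv).
  intros m n [x Hx].
  destruct (Heta m n) as [y1 [y2 [Hev Hmge]]].
  assert (Hy : is_mge M op m n y1 y2).
  { apply Hmge. exists x, e. now apply solution_equalizer. }
  destruct (Hinv y2) as [w [Hw [Hy2w _]]].
  { apply (mge_right_invertible M op e op_e m n y1); [exact Hy | now exists x]. }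
  exists (op y1 w). split.
  - exact (eval_solve_prog cop ceta cinv _ _ _ _ _ Hev Hw (Hop y1 w)).
  - exact (equalizer_solution M op e op_assoc op_e m n y1 y2 w (proj1 Hy) Hy2w).
Qed.
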